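(* Let $G$ be a connected graph such that every end $\omega$ of $G$ has a neighbourhood $C(X,\omega)$ (for some finite $X \subseteq V(G)$) which, as a graph, has a normal spanning tree. Then $G$ has a normal spanning tree.
   Context: Ends of $G$: equivalence classes of rays (one-way infinite paths), two rays being equivalent if no finite vertex set separates them. For finite $X \subseteq V(G)$ and an end $\omega$, $C(X,\omega)$ is the component of $G-X$ containing a tail of every ray of $\omega$ (such components are the neighbourhoods of $\omega$). A rooted spanning tree $T$ of a graph $H$ is normal if the endvertices of every $T$-path in $H$ (non-trivial path meeting $T$ only in its endvertices) are comparable in the tree-order of $T$. *)

(* Defs.v *)
From mathcomp Require Import all_boot.
From mathcomp Require Import boolp classical_sets functions cardinality.

Set Implicit Arguments.
Unset Strict Implicit.
Unset Printing Implicit Defensive.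

Local Open Scope classical_set_scope.

Section Graphs.
Variable V : Type.

(* Simple graphs, finite or infinite, whose vertices form a subset of V; all
   graphs on the same V can thus be compared as subgraphs. *)
Record graph := Graph {
  vertices : set V;
  adj : V -> V -> Prop;
  adj_sym : forall x y, adj x y -> adj y x;
  adj_irrefl : forall x, ~ adj x x;
  adj_vertices : forall x y, adj x y -> vertices x
}.

Definition subgraph (H G : graph) : Prop :=
  vertices H `<=` vertices G /\ (forall x y, adj H x y -> adj G x y).

Section Delete.
Variables (G : graph) (X : set V).

Let del_adj x y := [/\ adj G x y, ~ X x & ~ X y].

Fact del_adj_sym x y : del_adj x y -> del_adj y x.
Proof. by case=> /adj_sym. Qed.

Fact del_adj_irrefl x : ~ del_adj x x.
Proof. by case=> /adj_irrefl. Qed.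

Fact del_adj_vertices x y : del_adj x y -> (vertices G `\` X) x.
Proof. by case=> /adj_vertices. Qed.

(* G - X *)
Definition delete : graph :=
  Graph del_adj_sym del_adj_irrefl del_adj_vertices.

End Delete.

(* The path p 0, ..., p n of length n; the values p i with n < i play no role. *)
Definition is_path (G : graph) (n : nat) (p : nat -> V) : Prop :=
  [/\ forall i, i <= n -> vertices G (p i),
      forall i j, i <= n -> j <= n -> p i = p j -> i = j
    & forall i, i < n -> adj G (p i) (p i.+1)].

Definition is_cycle (G : graph) (n : nat) (p : nat -> V) : Prop :=
  [/\ is_path G n p, 2 <= n & adj G (p n) (p 0)].

Definition is_ray (G : graph) (r : nat -> V) : Prop :=
  injective r /\ forall i, adj G (r i) (r i.+1).

(* The empty graph is not connected. *)
Definition is_connected (G : graph) : Prop :=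
  vertices G !=set0 /\
  forall x y, vertices G x -> vertices G y ->
    exists n p, [/\ is_path G n p, p 0 = x & p n = y].

Definition is_component (G C : graph) : Prop :=
  [/\ subgraph C G, is_connected C
    & forall D, subgraph D G -> is_connected D -> subgraph C D -> subgraph D C].

Definition separates (G : graph) (X A B : set V) : Prop :=
  forall n p, is_path G n p -> A (p 0) -> B (p n) ->
    exists2 i, i <= n & X (p i).

Definition ray_equiv (G : graph) (r s : nat -> V) : Prop :=
  forall X : set V, finite_set X -> X `<=` vertices G ->
    ~ separates G X (range r) (range s).

(* The set of ends of G, each end being a class of equivalent rays. *)
Definition ends (G : graph) : set (set (nat -> V)) :=
  [set w | exists2 r, is_ray G r
                    & w = [set s | is_ray G s /\ ray_equiv G r s]].

(* C = C(X, w) *)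
Definition end_component (G : graph) (X : set V) (w : set (nat -> V))
    (C : graph) : Prop :=
  is_component (delete G X) C /\
  forall r, w r -> exists n, forall i, n <= i -> vertices C (r i).

Definition is_tree (T : graph) : Prop :=
  is_connected T /\ forall n p, ~ is_cycle T n p.

(* The tree-order of T with root r: x lies on the path from r to y in T. *)
Definition tree_le (T : graph) (r x y : V) : Prop :=
  exists n p, [/\ is_path T n p, p 0 = r, p n = y & exists2 i, i <= n & p i = x].

(* A T-path in H: a non-trivial path in H whose intersection with T, as a
   graph, consists of its two endvertices. *)
Definition is_Tpath (H T : graph) (n : nat) (p : nat -> V) : Prop :=
  [/\ is_path H n p, 0 < n,
      forall i, i <= n -> (vertices T (p i) <-> i = 0 \/ i = n)
    & forall i, i < n -> ~ adj T (p i) (p i.+1)].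

Definition is_normal (H T : graph) (r : V) : Prop :=
  forall n p, is_Tpath H T n p -> tree_le T r (p 0) (p n) \/ tree_le T r (p n) (p 0).

Definition normal_spanning_tree (H T : graph) (r : V) : Prop :=
  [/\ is_tree T, subgraph T H, vertices T = vertices H, vertices T r
    & is_normal H T r].

Definition has_normal_spanning_tree (H : graph) : Prop :=
  exists T r, normal_spanning_tree H T r.

End Graphs.

(* Main.v *)
Require Import Defs.
From mathcomp Require Import all_boot.
From mathcomp Require Import boolp classical_sets functions cardinality.
From mathcomp Require Import zify.

Set Implicit Arguments.
Unset Strict Implicit.
Unset Printing Implicit Defensive.

Local Open Scope classical_set_scope.

(* Call a set of vertices dispersed if every ray can be separated from it by a
   finite set of vertices, and sigma-dispersed if countably many dispersed sets
   cover it.  The levels of a normal spanning tree of a component of [G - X],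
   with [X] finite, are dispersed in [G], so every end has a sigma-dispersed
   neighbourhood with finite boundary.  Let [G'] be the subgraph induced by the
   union of these neighbourhoods.  The vertices outside [G'] form a dispersed
   set.  Since boundaries are finite, a component of [G'] is covered by countably
   many neighbourhoods, hence sigma-dispersed; since the neighbourhood of an end
   meets only one component of [G'], uniting the n-th dispersed sets of all
   components yields a dispersed set again.  So the whole vertex set is
   sigma-dispersed, covered by dispersed sets [U 0, U 1, ...], say.

   Then [G] has a normal spanning tree (Jung): grow the branch towards a vertex
   [v] by always stepping to a neighbour of the current vertex, in the component
   [D] that still contains [v], that is closest within [D] to the first [U n]
   meeting [D].  A branch that never reached [v] would be a ray that no finite
   set separates from some [U n]. *)

(** * Walks and reachability within a vertex set *)

Section Walks.
Variables (V : Type) (G : graph V).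

(** The length is an index because distances are compared later on; vertices may repeat, so
    concatenation is immediate. *)
Inductive walk (A : set V) : nat -> V -> V -> Prop :=
| walk_nil x : A x -> walk A 0 x x
| walk_cons k x y z : A x -> adj G x y -> walk A k y z -> walk A k.+1 x z.

Definition reach (A : set V) x y := exists k, walk A k x y.

Lemma walk_inv A k x z : walk A k x z ->
  x = z \/ exists l y, [/\ k = l.+1, adj G x y & walk A l y z].
Proof. by case=> [|{}k {}x y {}z _ xy yz]; [left | right; exists k, y]. Qed.

Lemma walk_fst A k x y : walk A k x y -> A x.
Proof. by case. Qed.

Lemma walk_lst A k x y : walk A k x y -> A y.
Proof. by elim. Qed.

Lemma walk_cat A k l x y z : walk A k x y -> walk A l y z -> walk A (k + l) x z.
Proof.
by elim=> [//|{}k {}x x' {}y Ax xx' _ IH] /IH; rewrite addSn; apply: walk_cons.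
Qed.

Lemma walk_edge A x y : A x -> A y -> adj G x y -> walk A 1 x y.
Proof. by move=> Ax Ay xy; apply: walk_cons xy _ => //; apply: walk_nil. Qed.

Lemma walk_rev A k x y : walk A k x y -> walk A k y x.
Proof.
elim=> [{}x Ax|{}k {}x z {}y Ax xz zy IH]; first exact: walk_nil.
rewrite -addn1; apply: walk_cat IH _; apply: walk_edge => //.
- exact: walk_fst zy.
- exact: adj_sym.
Qed.

Lemma walk_sub (A B : set V) k x y : A `<=` B -> walk A k x y -> walk B k x y.
Proof.
move=> AB; elim=> [{}x /AB|{}k {}x z {}y /AB Bx xz _]; first exact: walk_nil.
exact: walk_cons.
Qed.

Lemma walk_invariant (A C : set V) k x y :
  (forall u v, A u -> C u -> adj G u v -> A v -> C v) ->
  walk A k x y -> C x -> walk (A `&` C) k x y.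
Proof.
move=> inv; elim=> [{}x Ax Cx|{}k {}x z {}y Ax xz zy IH Cx].
  exact: walk_nil.
apply: (walk_cons _ xz) => //; apply: IH.
exact: inv Ax Cx xz (walk_fst zy).
Qed.

Lemma reach_refl (A : set V) x : A x -> reach A x x.
Proof. by move=> Ax; exists 0; apply: walk_nil. Qed.

Lemma reach_trans A x y z : reach A x y -> reach A y z -> reach A x z.
Proof. by move=> [k xy] [l yz]; exists (k + l); apply: walk_cat xy yz. Qed.

Lemma reach_sym A x y : reach A x y -> reach A y x.
Proof. by move=> [k xy]; exists k; apply: walk_rev. Qed.

Lemma reach_edge (A : set V) x y : A x -> A y -> adj G x y -> reach A x y.
Proof. by move=> Ax Ay xy; exists 1; apply: walk_edge. Qed.

Lemma reach_sub (A B : set V) x y : A `<=` B -> reach A x y -> reach B x y.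
Proof. by move=> AB [k xy]; exists k; apply: walk_sub xy. Qed.

Lemma reach_invariant (A C : set V) x y :
  (forall u v, C u -> adj G u v -> A v -> C v) -> reach A x y -> C x -> C y.
Proof.
by move=> inv [k xy] Cx;
  case: (walk_lst (walk_invariant (fun u v _ => inv u v) xy Cx)).
Qed.

Lemma walk_path (A : set V) k x y : walk A k x y ->
  exists n p, [/\ p 0 = x, p n = y, forall i, i <= n -> A (p i),
    forall i j, i <= n -> j <= n -> p i = p j -> i = j
  & forall i, i < n -> adj G (p i) (p i.+1)].
Proof.
elim=> [{}x Ax|{}k {}x z {}y Ax xz _ [n [p [p0 pn pA pI pE]]]].
  by exists 0, (fun=> x); split=> // i j; rewrite !leqn0 => /eqP-> /eqP->.
(* If [x] already lies on the path, the part before it is dropped. *)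
have [[i in_ pix]|xN] := pselect (exists2 i, i <= n & p i = x).
  exists (n - i), (fun j => p (i + j)); split; first by rewrite addn0.
  - by rewrite subnKC.
  - by move=> j jn; apply: pA; lia.
  - by move=> j l jn ln jl; suff: i + j = i + l by [lia]; apply: pI => //; lia.
  - by move=> j jn; rewrite addnS; apply: pE; lia.
exists n.+1, (fun j => if j is j'.+1 then p j' else x); split=> //.
- by case=> // i; apply: pA.
- case=> [|i] [|j] //= ilt jlt.
  + by move=> xE; case: xN; exists j.
  + by move=> xE; case: xN; exists i.
  + by move=> /pI->.
- by case=> [_|i]; [rewrite p0 | apply: pE].
Qed.

Lemma path_walk (A : set V) n p i j :
  (forall l, i <= l <= j -> A (p l)) ->
  (forall l, l < n -> adj G (p l) (p l.+1)) ->
  i <= j <= n -> walk A (j - i) (p i) (p j).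
Proof.
elim: j => [|j IH] Ap pE /andP[ij jn].
  by move: ij Ap; rewrite leqn0 => /eqP-> Ap; apply: walk_nil; apply: Ap.
move: ij; rewrite leq_eqVlt => /orP[/eqP ij|ij].
  by rewrite -ij subnn; apply: walk_nil; apply: Ap; lia.
rewrite subSn // -addn1; apply: walk_cat.
  by apply: IH => //; [move=> l lij; apply: Ap; lia | lia].
by apply: walk_edge; [apply: Ap; lia | apply: Ap; lia | apply: pE].
Qed.

Lemma is_path_reach (A : set V) n p i j : is_path G n p ->
  (forall l, i <= l <= j -> A (p l)) -> i <= j <= n -> reach A (p i) (p j).
Proof. by case=> _ _ pE Ap ijn; exists (j - i); apply: path_walk pE ijn. Qed.

Lemma reach_is_path (A : set V) x y : A `<=` vertices G -> reach A x y ->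
  exists n p, [/\ is_path G n p, p 0 = x, p n = y
    & forall i, i <= n -> A (p i)].
Proof.
move=> AG [k /walk_path[n [p [p0 pn pA pI pE]]]].
by exists n, p; split=> //; split=> // i /pA/AG.
Qed.

Lemma connected_reach x y : is_connected G -> vertices G x -> vertices G y ->
  reach (vertices G) x y.
Proof.
move=> [_ Gc] Gx Gy; have [n [p [pP <- <-]]] := Gc _ _ Gx Gy.
apply: (is_path_reach pP) => [l /andP[_ ln]|]; last by rewrite leqnn andbT.
by case: pP => pG _ _; apply: pG.
Qed.

Lemma reach_connected x : vertices G x ->
  (forall y, vertices G y -> reach (vertices G) x y) -> is_connected G.
Proof.
move=> Gx Gr; split; first by exists x.
move=> y z /Gr/reach_sym yx /Gr xz.
have [n [p [pP p0 pn _]]] :=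
  reach_is_path (fun _ h => h) (reach_trans yx xz).
by exists n, p.
Qed.

End Walks.

(** * Uniqueness of paths in trees *)

Section Trees.
Variables (V : Type) (T : graph V).

Lemma is_path_prefix n p m : is_path T n p -> m <= n -> is_path T m p.
Proof.
move=> [pV pI pE] mn; split=> [i im|i j im jm|i im].
- by apply: pV; lia.
- by apply: pI; lia.
- by apply: pE; lia.
Qed.

(* Two paths that enter their common endvertex from different vertices close up
   to a cycle. *)
Lemma tree_path_pred n p m q : is_tree T ->
  is_path T n.+1 p -> is_path T m.+1 q -> p 0 = q 0 -> p n.+1 = q m.+1 ->
  p n = q m.
Proof.
move=> [_ acyc] pP qP p0 pq; apply: contrapT => pqN.
have [pV pI pE] := pP; have [qV qI qE] := qP.
(* Away from the common end [v], the two predecessors are joined through the common start; closing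
   such a path [f] up at [v] gives the cycle [g]. *)
pose v := p n.+1; pose A := vertices T `\` [set v].
have Ap l : l <= n -> A (p l).
  move=> ln; split; first by apply: pV; lia.
  by move=> e; suff: l = n.+1 by [lia]; apply: pI => //; lia.
have Aq l : l <= m -> A (q l).
  move=> ln; split; first by apply: qV; lia.
  by rewrite /v pq => e; suff: l = m.+1 by [lia]; apply: qI => //; lia.
have pr : reach T A (p 0) (p n).
  by apply: (is_path_reach pP) => [l /andP[_]|//]; [apply: Ap | lia].
have qr : reach T A (q 0) (q m).
  by apply: (is_path_reach qP) => [l /andP[_]|//]; [apply: Aq | lia].
have [|k [f [[fV fI fE] f0 fk fA]]] :=
  @reach_is_path _ T A (p n) (q m) (fun _ => @proj1 _ _).
  by apply: reach_trans (reach_sym pr) _; rewrite p0.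
pose g i := if i <= k then f i else v.
have gk i : i <= k -> g i = f i by rewrite /g => ->.
have gv : g k.+1 = v by rewrite /g ltnn.
have k0 : 0 < k.
  by rewrite lt0n; apply/eqP => k0; apply: pqN; rewrite -f0 -fk k0.
have fv i : i <= k -> f i <> v by move=> ik; case: (fA _ ik).
apply: (acyc k.+1 g); split=> //.
- split=> [i|i j|i].
  + rewrite leq_eqVlt => /orP[/eqP->|ik]; first by rewrite gv; apply: pV.
    by rewrite gk //; apply: fV.
  + rewrite leq_eqVlt => /orP[/eqP->|ik];
      rewrite leq_eqVlt => /orP[/eqP->//|jk]; rewrite ?gv !gk //.
    * by move/esym/fv => /(_ jk).
    * by move/fv => /(_ ik).
    * exact: fI.
  + rewrite ltnS leq_eqVlt => /orP[/eqP->|ik].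
      by rewrite gv gk // fk /v pq; apply: qE.
    by rewrite !gk //; [apply: fE | apply: ltnW].
- by rewrite gv gk // f0; apply: adj_sym; apply: pE.
Qed.

Lemma tree_path_unique n p m q : is_tree T ->
  is_path T n p -> is_path T m q -> p 0 = q 0 -> p n = q m ->
  n = m /\ forall i, i <= n -> p i = q i.
Proof.
move=> Ttree; elim: n m => [|n IH] [|m] pP qP p0 pq.
- by split=> // i; rewrite leqn0 => /eqP->.
- case: qP => _ qI _; suff: 0 = m.+1 by [].
  by apply: qI => //; rewrite -p0 pq.
- case: pP => _ pI _; suff: 0 = n.+1 by [].
  by apply: pI => //; rewrite p0 pq.
have pqn := tree_path_pred Ttree pP qP p0 pq.
have [||nm IHpq] := IH m _ _ p0 pqn.
- exact: is_path_prefix pP _.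
- exact: is_path_prefix qP _.
split=> [|i]; first by rewrite nm.
rewrite leq_eqVlt => /orP[/eqP->|]; last exact: IHpq.
by rewrite pq nm.
Qed.

End Trees.

(** * Normal spanning trees as systems of branches *)

Section Branches.
Variable V : Type.

(* [P v 0, ..., P v (h v)] is the path from the root to [v] in a normal
   spanning tree of [H]. *)
Record branches (H : graph V) (r : V) (h : V -> nat) (P : V -> nat -> V) :
    Prop := Branches {
  branch_root : forall v, vertices H v -> P v 0 = r;
  branch_last : forall v, vertices H v -> P v (h v) = v;
  branch_adj : forall v i, vertices H v -> i < h v -> adj H (P v i) (P v i.+1);
  branch_prefix : forall v i, vertices H v -> i <= h v ->
    [/\ vertices H (P v i), h (P v i) = i
      & forall j, j <= i -> P (P v i) j = P v j];
  branch_comparable : forall u v, adj H u v ->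
    (h u <= h v /\ P v (h u) = u) \/ (h v <= h u /\ P u (h v) = v)
}.

(** Tree paths from the root are unique, so initial segments of branches are branches. For a tree
    edge one branch extends the other; any other edge of [H] is a [T]-path of length 1, to which
    normality applies. *)
Lemma normal_tree_branches (H T : graph V) r :
  normal_spanning_tree H T r -> exists h P, branches H r h P.
Proof.
move=> [Ttree [_ THa] THv Tr Tn].
have ex v : exists np : nat * (nat -> V), vertices H v ->
    [/\ is_path T np.1 np.2, np.2 0 = r & np.2 np.1 = v].
  have [Hv|] := pselect (vertices H v); last by exists (0, fun=> r).
  have [[_ Tc] _] := Ttree; rewrite -THv in Hv.
  by have [n [p [pP p0 pn]]] := Tc _ _ Tr Hv; exists (n, p).
have [f fP] := choice ex.
have unique v n p : is_path T n p -> p 0 = r -> p n = v ->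
    n = (f v).1 /\ forall i, i <= n -> p i = (f v).2 i.
  move=> pP p0 pn.
  have Hv : vertices H v by rewrite -pn -THv; case: pP => pV _ _; apply: pV.
  have [qP q0 qm] := fP _ Hv.
  by apply: (tree_path_unique Ttree pP qP); rewrite ?p0 ?pn ?q0 ?qm.
have le_branch u v : tree_le T r u v ->
    (f u).1 <= (f v).1 /\ (f v).2 ((f u).1) = u.
  move=> [n [p [pP p0 pn [i in_ piu]]]].
  have [nE pE] := unique _ _ _ pP p0 pn.
  have [iE _] := unique _ _ _ (is_path_prefix pP in_) p0 piu.
  by rewrite -iE -nE; split=> //; rewrite -pE.
exists (fun v => (f v).1), (fun v => (f v).2); split.
- by move=> v /fP[].
- by move=> v /fP[].
- by move=> v i /fP[[_ _ pE] _ _] /pE/THa.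
- move=> v i /fP[pP p0 _] ile.
  have [iE pE] := unique _ _ _ (is_path_prefix pP ile) p0 erefl.
  split=> [|//|j ji]; last by rewrite -pE.
  by case: pP => pV _ _; rewrite -THv; apply: pV.
move=> u v uv; have Hu := adj_vertices uv; have Hv := adj_vertices (adj_sym uv).
have [Tuv|TNuv] := pselect (adj T u v).
  have [pP p0 pn] := fP _ Hu.
  have [[i ile iv]|vN] := pselect (exists2 i, i <= (f u).1 & (f u).2 i = v).
    by right; apply: le_branch; exists (f u).1, (f u).2; split=> //; exists i.
  left; apply: le_branch.
  pose q i := if i <= (f u).1 then (f u).2 i else v.
  have qlt i : i <= (f u).1 -> q i = (f u).2 i by rewrite /q => ->.
  have qv : q (f u).1.+1 = v by rewrite /q ltnn.
  have [pV pI pE] := pP.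
  exists (f u).1.+1, q; split=> //; last by exists (f u).1 => //; rewrite qlt.
  split=> [i|i j|i].
  + rewrite leq_eqVlt => /orP[/eqP->|ik]; last by rewrite qlt //; apply: pV.
    by rewrite qv THv.
  + rewrite leq_eqVlt => /orP[/eqP->|ik];
      rewrite leq_eqVlt => /orP[/eqP->//|jk]; rewrite ?qv !qlt //.
    * by move=> jv; case: vN; exists j.
    * by move=> iv; case: vN; exists i.
    * exact: pI.
  + rewrite ltnS leq_eqVlt => /orP[/eqP->|ik]; first by rewrite qv qlt // pn.
    by rewrite !qlt //; [apply: pE | apply: ltnW].
pose e i := if i is 0 then u else v.
have: is_Tpath H T 1 e.
  split=> //; last by case.
    split; first by case=> [|[|]].
      case=> [|[|]] // [|[|]] //= _ _ uvE; case: (@adj_irrefl _ H u).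
        by rewrite {2}uvE.
      by rewrite -{2}uvE.
    by case.
  by case=> [|[|]] //= _; rewrite THv; split=> // _; [left|right].
by move=> /Tn[] /le_branch; [left|right].
Qed.

Section BranchTree.
Variables (H : graph V) (r : V) (h : V -> nat) (P : V -> nat -> V).
Hypotheses (Hr : vertices H r) (bP : branches H r h P).

Let parent u v := [/\ vertices H v, h v = (h u).+1 & P v (h u) = u].

Let tree_adj u v := parent u v \/ parent v u.

Fact tree_adj_sym u v : tree_adj u v -> tree_adj v u.
Proof. by case; [right|left]. Qed.

Fact tree_adj_irrefl u : ~ tree_adj u u.
Proof. by case=> -[_ /eqP]; rewrite -[X in X == _]addn0 -addn1 eqn_add2l. Qed.

Lemma parent_adj u v : parent u v -> adj H u v.
Proof.
move=> [Hv hv Pv]; have := branch_adj bP Hv (i := h u).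
by rewrite hv leqnn Pv -hv (branch_last bP Hv); apply.
Qed.

Fact tree_adj_vertices u v : tree_adj u v -> vertices H u.
Proof. by case=> [/parent_adj uv|[]//]; apply: adj_vertices uv. Qed.

Definition branch_tree : graph V :=
  Graph tree_adj_sym tree_adj_irrefl tree_adj_vertices.

Lemma branch_is_path v : vertices H v -> is_path branch_tree (h v) (P v).
Proof.
move=> Hv; split=> [i ile|i j ile jle ij|i ilt].
- by have [] := branch_prefix bP Hv ile.
- have [_ <- _] := branch_prefix bP Hv ile.
  by have [_ <- _] := branch_prefix bP Hv jle; rewrite ij.
left; have [Hi hi _] := branch_prefix bP Hv (ltnW ilt).
by have [Hi' hi' Pi'] := branch_prefix bP Hv ilt; split; rewrite ?hi ?hi' ?Pi'.
Qed.

Lemma branch_le u v : vertices H v -> h u <= h v -> P v (h u) = u ->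
  tree_le branch_tree r u v.
Proof.
move=> Hv uv Pu; exists (h v), (P v); split; last by exists (h u).
- exact: branch_is_path.
- exact: branch_root bP _ Hv.
- exact: branch_last bP _ Hv.
Qed.

Lemma branch_connected : is_connected branch_tree.
Proof.
apply: (@reach_connected _ _ r) => // v Hv.
rewrite -(branch_root bP Hv) -{2}(branch_last bP Hv).
apply: (is_path_reach (branch_is_path Hv)) => [l /andP[_ lh]|]; last first.
  by rewrite leqnn.
by have [] := branch_prefix bP Hv lh.
Qed.

Lemma parent_unique u w v : parent u v -> parent w v -> u = w.
Proof.
by move=> [_ hu <-] [_ hw <-]; move: hw; rewrite hu => -[->].
Qed.

(* Both neighbours on a cycle of a vertex of maximal height would be its
   parent. *)
Lemma branch_acyclic n p : ~ is_cycle branch_tree n p.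
Proof.
move=> [[pV pI pE] n2 pn].
have [i ile imax] : exists2 i, i <= n & forall j, j <= n -> h (p j) <= h (p i).
  have [i _ imax] := @arg_maxnP _ ord0 xpredT (fun i : 'I_n.+1 => h (p i)) isT.
  exists i => [|j jn]; first by rewrite -ltnS.
  have jn' : j < n.+1 by [].
  exact: (imax (Ordinal jn')).
have par j : j <= n -> tree_adj (p j) (p i) -> parent (p j) (p i).
  by move=> jn [//|[_ hj _]]; have := imax _ jn; rewrite hj ltnn.
suff [j [k [jn kn jk /par pj /par pk]]] : exists j k,
    [/\ j <= n, k <= n, j <> k, tree_adj (p j) (p i) & tree_adj (p k) (p i)].
  by apply: jk; apply: pI => //; apply: parent_unique (pj jn) (pk kn).
(* The cyclic neighbours of [i] wrap around at [0] and at [n]; [2 <= n] keeps them distinct. *)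
have [i0|ipos] := posnP i.
  exists 1, n; split=> //; [lia | lia | | by rewrite i0].
  by rewrite i0; apply: tree_adj_sym; apply: pE; lia.
have prev : tree_adj (p i.-1) (p i).
  by rewrite -{2}(prednK ipos); apply: pE; lia.
move: ile; rewrite leq_eqVlt => /orP[/eqP iN|ilt].
  exists 0, i.-1; split=> //; [lia | lia |].
  by rewrite iN; apply: tree_adj_sym.
exists i.-1, i.+1; split=> //; [lia | lia |].
by apply: tree_adj_sym; apply: pE.
Qed.

(** As the tree spans [H], a [T]-path has no inner vertex; it is a single edge, whose ends are
    comparable. *)
Lemma branches_normal_tree : normal_spanning_tree H branch_tree r.
Proof.
split=> //.
- by split; [exact: branch_connected | exact: branch_acyclic].
- by split=> // u v [/parent_adj//|/parent_adj vu]; apply: adj_sym.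
move=> n p [[pV pI pE] n0 pT _].
have n1 : n = 1.
  by case: n n0 pV pT {pI pE} => [|[|n]] // _ pV /(_ 1 isT)[/(_ (pV 1 isT))[]].
have := pE _ n0; rewrite n1 => uv.
have [[uv' Pu]|[uv' Pv]] := branch_comparable bP uv; [left|right].
  by apply: branch_le => //; apply: adj_vertices (adj_sym uv).
by apply: branch_le => //; apply: adj_vertices uv.
Qed.

End BranchTree.
End Branches.

(** * Components of a graph *)

Section Components.
Variables (V : Type) (G : graph V).

Lemma walk_subgraph (H K : graph V) (A : set V) k x y :
  (forall u v, adj H u v -> adj K u v) -> walk H A k x y -> walk K A k x y.
Proof.
move=> HK; elim=> [|{}k {}x z {}y Ax xz _]; first by move=> *; apply: walk_nil.
by apply: walk_cons Ax _; apply: HK.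
Qed.

(** The vertices reachable from [x] induce a connected subgraph that contains [C], hence lies in [C]
    by maximality. *)
Lemma component_adj C x y : is_component G C -> vertices C x -> adj G x y ->
  adj C x y.
Proof.
move=> [[CGv CGa] Cc Cmax] Cx xy.
pose R := [set z | reach G (vertices G) x z].
have RG : R `<=` vertices G by move=> z [k xz]; apply: walk_lst xz.
pose D := delete G (~` R).
have DE u v : adj G u v -> R u -> R v -> adj D u v
  by move=> uv Ru Rv; split=> //; apply.
have Rx : R x by apply: reach_refl; apply: CGv.
have DV z : R z -> vertices D z by move=> Rz; split; [exact: RG | apply].
have VD z : vertices D z -> R z by case=> _ /contrapT.
have Dr z w : reach G (vertices G) z w -> R w -> reach D (vertices D) z w.
  move=> [k]; elim=> [{}z _ Rz|{}k {}z z' {}w Gz zz' z'w IH Rw].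
    by apply: reach_refl; apply: DV.
  apply: reach_trans (IH Rw).
  have Rz' : R z' by apply: reach_trans Rw _; apply: reach_sym; exists k.
  have Rz : R z.
    apply: (reach_trans Rz').
    by apply: (reach_edge _ Gz (adj_sym zz')); apply: RG.
  by apply: reach_edge; [exact: DV | exact: DV | exact: DE].
have Dc : is_connected D.
  apply: (@reach_connected _ _ x); first exact: DV.
  by move=> z /VD xz; apply: Dr.
have CR u : vertices C u -> R u.
  move=> Cu; have [k xu] := connected_reach Cc Cx Cu.
  by exists k; apply: walk_sub CGv _; apply: walk_subgraph xu.
have CD : subgraph C D.
  split=> [u /CR/DV //|u v uv]; apply: DE; first exact: CGa.
    exact: CR (adj_vertices uv).
  exact: CR (adj_vertices (adj_sym uv)).
have DG : subgraph D G by split=> [u [] //|u v []].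
have [_] := Cmax D DG Dc CD; apply.
apply: DE => //; apply: reach_edge => //; first exact: RG.
exact: adj_vertices (adj_sym xy).
Qed.

End Components.

(** * Dispersed and sigma-dispersed sets *)

Section Dispersed.
Variables (V : Type) (G : graph V).

Definition dispersed (U : set V) : Prop := forall p, is_ray G p ->
  exists2 Y, finite_set Y & forall i u, U u -> ~ reach G (~` Y) (p i) u.

Definition sigma_dispersed (A : set V) : Prop :=
  exists2 U : nat -> set V, forall n, dispersed (U n) & A `<=` \bigcup_n U n.

Lemma finite_eventually (Y : set V) (Q : V -> nat -> Prop) : finite_set Y ->
  (forall y, Y y -> exists N, forall i, N <= i -> Q y i) ->
  exists N, forall y i, Y y -> N <= i -> Q y i.
Proof.
move=> Yfin YQ.
have /choice[N NP] : forall y, exists N, Y y -> forall i, N <= i -> Q y i.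
  move=> y; have [Yy|?] := pselect (Y y); last by exists 0.
  by have [N NP] := YQ y Yy; exists N.
have /finite_seqP[s sE] := finite_image N Yfin.
exists (\max_(n <- s) n) => y i Yy si; apply: NP => //.
apply: leq_trans si; apply: (leq_bigmax_seq (F := id)) => //.
by have : (N @` Y) (N y) by [exists y]; rewrite sE.
Qed.

Lemma ray_eventually_notin p (Y : set V) : is_ray G p -> finite_set Y ->
  exists N, forall i, N <= i -> ~ Y (p i).
Proof.
move=> [pI _] Yfin.
have [|N NP] := @finite_eventually Y (fun y i => p i <> y) Yfin.
  move=> y _; have [[j pj]|yN] := pselect (exists j, p j = y).
    by exists j.+1 => i ji; rewrite -pj => /pI; lia.
  by exists 0 => i _ piy; apply: yN; exists i.
by exists N => i Ni Yi; apply: (NP _ i Yi Ni).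
Qed.

(** The finitely many vertices of the ray before the tail can be added to the separator; nothing is
    reachable from a deleted vertex. *)
Lemma dispersed_tail (U : set V) :
  (forall p, is_ray G p -> exists Y N, finite_set Y /\
     forall i u, N <= i -> U u -> ~ reach G (~` Y) (p i) u) -> dispersed U.
Proof.
move=> h p /h[Y [N [Yfin YU]]]; exists (Y `|` p @` `I_N).
  by rewrite finite_setU; split=> //; apply: finite_image.
move=> i u Uu pu; have [k pk] := pu; have piN := walk_fst pk.
apply: (YU i u) => //; last by apply: reach_sub pu => z zN Yz; apply: zN; left.
by rewrite leqNgt; apply/negP => iN; apply: piN; right; exists i.
Qed.

Lemma dispersed0 : dispersed set0.
Proof. by move=> p _; exists set0. Qed.

Lemma sigma_dispersed_sub (A B : set V) :
  A `<=` B -> sigma_dispersed B -> sigma_dispersed A.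
Proof. by move=> AB [U Ud BU]; exists U => // x /AB/BU. Qed.

Lemma sigma_dispersed_bigcup (I : Type) (D : set I) (F : I -> set V) :
  countable D -> (forall i, D i -> sigma_dispersed (F i)) ->
  sigma_dispersed (\bigcup_(i in D) F i).
Proof.
move=> /countable_injP[g gI] FD.
have /choice[U UP] : forall i, exists U : nat -> set V,
    D i -> (forall n, dispersed (U n)) /\ F i `<=` \bigcup_n U n.
  move=> i; have [/FD[U Ud FU]|?] := pselect (D i); last by exists (fun=> set0).
  by exists U.
(* [m] codes a pair [(a, n)], and [W m] is the [n]-th dispersed set of the index with code [a],
   unique by injectivity of [g] on [D]; without such an index it is empty. *)
pose W m := if unpickle m is Some (a, n)
  then [set x | exists2 i, D i & g i = a /\ U i n x] else set0.
exists W => [m|x [i Di Fix]].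
  rewrite /W; case: unpickle => [[a n]|]; last exact: dispersed0.
  have [[i [Di gi]]|iN] := pselect (exists i, D i /\ g i = a); last first.
    suff -> : [set x | exists2 i, D i & g i = a /\ U i n x] = set0.
      exact: dispersed0.
    by rewrite -subset0 => x [i Di [gi _]]; apply: iN; exists i.
  suff -> : [set x | exists2 i, D i & g i = a /\ U i n x] = U i n.
    by have [+ _] := UP i Di; apply.
  apply/seteqP; split=> [x [j Dj [gj Ux]]|x Ux]; last by exists i.
  by have -> : i = j by apply: gI; rewrite ?inE // gi.
have [_ /(_ x Fix)[n _ Ux]] := UP i Di.
by exists (pickle (g i, n)) => //; rewrite /W pickleK; exists i.
Qed.

(* A ray in the component runs, from some point on, above a fixed vertex [c] of
   height [n.+1]; the finitely many vertices below [c] cut it off from level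
   [n]. *)
Lemma component_level_dispersed (X : set V) C r h P n : finite_set X ->
  is_component (delete G X) C -> branches C r h P ->
  dispersed [set v | vertices C v /\ h v = n].
Proof.
move=> Xfin CX bP; apply: dispersed_tail => p pray.
have [N0 N0P] := ray_eventually_notin pray Xfin.
have [pI pE] := pray.
have CX' u : vertices C u -> ~ X u.
  by move=> Cu; case: CX => -[Csub _] _ _; have [] := Csub _ Cu.
have closed u v : vertices C u -> adj G u v -> ~ X v -> adj C u v.
  by move=> Cu uv Xv; apply: (component_adj CX Cu); split=> //; apply: CX'.
have closedV u v : vertices C u -> adj G u v -> ~ X v -> vertices C v.
  by move=> Cu uv Xv; apply: adj_vertices (adj_sym (closed _ _ Cu uv Xv)).
(* Past its last visit to [X] the ray stays inside or outside [C]; in the latter case [X] alone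
   separates its tail from [C]. *)
have [CN0|CN0] := pselect (vertices C (p N0)); last first.
  exists X, N0; split=> // i u Ni [Cu _] pu.
  have Cpi : vertices C (p i).
    exact: (reach_invariant closedV (reach_sym pu)).
  apply: CN0; move: Cpi; rewrite -(subnKC Ni); elim: (i - N0) => [|k IH].
    by rewrite addn0.
  rewrite addnS => Ck; apply: IH.
  by apply: (closedV _ _ Ck (adj_sym (pE _))); apply: N0P; lia.
have Cp i : N0 <= i -> vertices C (p i).
  move=> /subnKC<-; elim: (i - N0) => [|k IH]; rewrite ?addn0 // addnS.
  by apply: (closedV _ _ IH (pE _)); apply: N0P; lia.
(* Induction on the height: the ray eventually misses [c], so it runs strictly above [c], and
   consecutive vertices, being comparable, have the same ancestor at height [m.+1]. *)
have above m : exists c N, N0 <= N /\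
    forall i, N <= i -> m <= h (p i) /\ P (p i) m = c.
  elim: m => [|m [c [N [N0N IH]]]].
    exists r, N0; split=> // i Ni; split=> //.
    by apply: (branch_root bP); apply: Cp.
  have [N1 N1P] := ray_eventually_notin pray (finite_set1 c).
  pose N2 := maxn N N1.
  have hlt i : N2 <= i -> m < h (p i).
    move=> N2i; have [|mh Pc] := IH i; first by lia.
    rewrite ltn_neqAle mh andbT; apply/eqP => mE.
    apply: (N1P i); first by lia.
    by rewrite /= -Pc mE (branch_last bP) //; apply: Cp; lia.
  exists (P (p N2) m.+1), N2; split=> [|i N2i]; first by lia.
  split; first exact: hlt.
  rewrite -(subnKC N2i); elim: (i - N2) => [|k IHk];
    rewrite ?addn0 // -IHk addnS.
  set j := N2 + k.
  have Cj : vertices C (p j) by apply: Cp; lia.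
  have Cj' : vertices C (p j.+1) by apply: Cp; lia.
  have jlt : m < h (p j) by apply: hlt; lia.
  have jlt' : m < h (p j.+1) by apply: hlt; lia.
  have /(branch_comparable bP) : adj C (p j) (p j.+1).
    by apply: closed => //; apply: N0P; lia.
  move=> [[hh PE]|[hh PE]].
    by have [_ _ /(_ _ jlt)] := branch_prefix bP Cj' hh; rewrite PE.
  by have [_ _ /(_ _ jlt')] := branch_prefix bP Cj hh; rewrite PE.
have [c [N [N0N cP]]] := above n.+1.
exists (X `|` P c @` `I_n.+1), N; split.
  by rewrite finite_setU; split=> //; apply: finite_image.
(* The vertices above [c]: outside [X], an edge can leave [K] only to a vertex strictly below [c],
   and those are deleted. *)
pose K := [set v | [/\ vertices C v, n < h v & P v n.+1 = c]].
move=> i u Ni [Cu hu] pu.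
suff [_ + _] : K u by rewrite hu ltnn.
apply: (reach_invariant _ pu); last first.
  by have [hi Pi] := cP _ Ni; split=> //; apply: Cp; lia.
move=> v w [Cv hv Pv] vw wN.
have Xw : ~ X w by move=> Xw; apply: wN; left.
have Cvw := closed _ _ Cv vw Xw; have Cw := closedV _ _ Cv vw Xw.
have [[hh PE]|[hh PE]] := branch_comparable bP Cvw.
  split=> //; first by lia.
  by have [_ _ /(_ _ hv)] := branch_prefix bP Cw hh; rewrite PE => <-.
have [hw|hw] := ltnP n (h w).
  split=> //.
  by have [_ _ /(_ _ hw)] := branch_prefix bP Cv hh; rewrite PE => ->.
case: wN; right; exists (h w) => //.
by have [_ _ /(_ (h w))] := branch_prefix bP Cv hv; rewrite Pv PE; apply; lia.
Qed.

Lemma component_sigma_dispersed (X : set V) C : finite_set X ->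
  is_component (delete G X) C -> has_normal_spanning_tree C ->
  sigma_dispersed (vertices C).
Proof.
move=> Xfin CX [T [r Tr]]; have [h [P bP]] := normal_tree_branches Tr.
exists (fun n => [set v | vertices C v /\ h v = n]) => [n|v Cv].
  exact: component_level_dispersed Xfin CX bP.
by exists (h v).
Qed.

(** * Cells and the components of their union *)

Definition cell (K : set V) : Prop :=
  [/\ exists2 X, finite_set X & forall x y, K x -> adj G x y -> K y \/ X y,
      forall x y, K x -> K y -> reach G K x y
    & sigma_dispersed K].

Lemma component_cell (X : set V) C : finite_set X ->
  is_component (delete G X) C -> has_normal_spanning_tree C ->
  cell (vertices C).
Proof.
move=> Xfin CX Cnst; have [[CGv CGa] Cc _] := CX.
split; last exact: component_sigma_dispersed Xfin CX Cnst.
- exists X => // x y Cx xy; have [|Xy] := pselect (X y); first by right.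
  left; suff xy' : adj C x y by exact: adj_vertices (adj_sym xy').
  by apply: (component_adj CX Cx); split=> //; have [] := CGv _ Cx.
- move=> x y Cx Cy; have [k xy] := connected_reach Cc Cx Cy.
  by exists k; apply: walk_subgraph xy => u v /CGa[].
Qed.

Section Cells.
Hypothesis ray_cell : forall p, is_ray G p ->
  exists2 K, cell K & exists N, forall i, N <= i -> K (p i).

Let covered : set V := [set x | exists2 K, cell K & K x].

Let block x := [set y | reach G covered x y].

(* As cells have finite boundaries, closing up under "add a cell around each
   boundary vertex" takes countably many cells. *)
Lemma block_sigma_dispersed x : sigma_dispersed (block x).
Proof.
have /choice[K KP] : forall y, exists K, covered y -> cell K /\ K y.
  move=> y; have [[K Kc Ky]|] := pselect (covered y); last by exists set0.
  by exists K.
have /choice[X XP] : forall y, exists X, finite_set X /\ (covered y ->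
    forall u v, K y u -> adj G u v -> K y v \/ X v).
  move=> y; have [/KP[[[X Xfin XK] _ _] _]|] := pselect (covered y).
    by exists X.
  by exists set0.
pose S n := iter n (fun A => \bigcup_(y in A) X y) [set x].
have Scount : countable (\bigcup_n S n).
  apply: bigcup_countable => // n _; elim: n => [|n IH] /=.
    by apply: finite_set_countable; apply: finite_set1.
  apply: bigcup_countable => // y _.
  by apply: finite_set_countable; have [] := XP y.
pose D := (\bigcup_n S n) `&` covered.
apply: (@sigma_dispersed_sub _ (\bigcup_(y in D) K y)); last first.
  apply: sigma_dispersed_bigcup => [|y [_ /KP[[]]] //].
  by apply: sub_countable Scount; apply: subset_card_le => y [].
move=> y xy; have [k xk] := xy; have xcov := walk_fst xk.
apply: (reach_invariant _ xy); last first.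
  by exists x; [split=> //; exists 0 | have [] := KP x xcov].
(* A step out of the cell of [z] lands in its boundary [X z], hence in round [n.+1], whose covered
   vertices have chosen cells of their own. *)
move=> u v [z [[n _ Sz] zcov] Kzu] uv vcov.
have [_ /(_ zcov u v Kzu uv)[Kzv|Xv]] := XP z.
  by exists z => //; split=> //; exists n.
exists v; last by have [] := KP v vcov.
by split=> //; exists n.+1 => //=; exists z.
Qed.

Lemma block_eq x y : reach G covered x y -> block x = block y.
Proof.
move=> xy; apply/seteqP; split=> z; apply: reach_trans => //.
exact: reach_sym.
Qed.

Lemma sigma_dispersedT : sigma_dispersed setT.
Proof.
(* The choice is indexed by sets rather than vertices, so that all vertices of a block share the
   same dispersed sets. *)
have /choice[U UP] : forall A, exists U : nat -> set V, sigma_dispersed A ->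
    (forall n, dispersed (U n)) /\ A `<=` \bigcup_n U n.
  move=> A; have [[U Ud AU]|] := pselect (sigma_dispersed A).
    by exists U.
  by exists (fun=> set0).
pose W n := if n is m.+1 then [set y | covered y /\ U (block y) m y]
            else ~` covered.
exists W => [n|y _]; last first.
  have [cy|ny] := pselect (covered y); last by exists 0.
  have [_ /(_ y)[|n _ Uy]] := UP _ (block_sigma_dispersed y).
    exact: reach_refl.
  by exists n.+1.
apply: dispersed_tail => p pray.
have [K Kcell [N KN]] := ray_cell pray.
have [[X Xfin XK] Kc _] := Kcell.
(* Deleting the boundary [X] of [K] confines to [K] whatever the tail reaches, hence to a single
   block. *)
have Kinv Y i u : N <= i -> reach G (~` (X `|` Y)) (p i) u -> K u.
  move=> Ni pu; apply: (reach_invariant _ pu); last exact: KN.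
  move=> v w Kv vw wN; have [//|Xw] := XK _ _ Kv vw.
  by case: wN; left.
have Kcov u : K u -> covered u by exists K.
case: n => [|n]; first last.
  have [Ud _] := UP _ (block_sigma_dispersed (p N)).
  have [Y Yfin YU] := Ud n _ pray.
  exists (X `|` Y), N; split; first by rewrite finite_setU.
  move=> i u Ni [_ Uu] pu; have Ku := Kinv _ _ _ Ni pu.
  apply: (YU i u); last by apply: reach_sub pu => z zN Yz; apply: zN; right.
  rewrite (@block_eq (p N) u) //.
  by apply: (reach_sub Kcov); apply: Kc => //; apply: KN.
exists (X `|` set0), N; split; first by rewrite finite_setU.
by move=> i u Ni uN pu; apply: uN; apply: Kcov; apply: Kinv pu.
Qed.

End Cells.
End Dispersed.

(** * Minima and bounded monotone sequences of natural numbers *)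

Lemma ex_least (Q : nat -> Prop) : (exists n, Q n) ->
  exists2 n, Q n & forall m, Q m -> n <= m.
Proof.
move=> [n Qn]; have ex : exists n, `[< Q n >] by exists n; apply/asboolP.
by case: (ex_minnP ex) => m /asboolP Qm mP; exists m => // l /asboolP/mP.
Qed.

Lemma bounded_nondecreasing_stationary (f : nat -> nat) m :
  (forall s, f s <= f s.+1) -> (forall s, f s <= m) ->
  exists N, forall s, N <= s -> f s = f N.
Proof.
move=> fS fm.
have [d [N dE] dmin] : exists2 d, (exists N, d = m - f N) &
    forall e, (exists N, e = m - f N) -> d <= e.
  by apply: ex_least; exists (m - f 0), 0.
exists N => s Ns; apply/eqP; rewrite eqn_leq.
have -> : f N <= f s.
  rewrite -(subnKC Ns); elim: (s - N) => [|k IH]; rewrite ?addn0 // addnS.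
  exact: leq_trans IH (fS _).
have := dmin (m - f s) (ex_intro _ s erefl); have := fm s; have := fm N; lia.
Qed.

(** * Jung's construction of the branches *)

Section Jung.
Variables (V : Type) (G : graph V) (r : V) (U : nat -> set V).
Hypotheses (Gc : is_connected G) (Gr : vertices G r).
Hypotheses (Ud : forall n, dispersed G (U n)) (UT : forall x, exists n, U n x).

Let least_index (D : set V) n :=
  (exists2 x, D x & U n x) /\ forall m x, D x -> U m x -> n <= m.

Let near (D : set V) x k :=
  exists n u, [/\ least_index D n, U n u & walk G D k x u].

Let closest (D : set V) t x := [/\ D x, adj G t x & exists2 k, near D x k &
  forall x' k', D x' -> adj G t x' -> near D x' k' -> k <= k'].

(** The choice depends on the component and the current vertex but not on the target, so branches
    agree while their components do. Once the target is reached its component is empty, and the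
    fallback [t] keeps the branch there. *)
Let next D t : V :=
  if pselect (exists x, closest D t x) is left ex then sval (cid ex) else t.

(* [stage v s] is the component containing [v] of [G] minus the first [s]
   vertices of the branch towards [v], with the next vertex of that branch. *)
Fixpoint stage (v : V) (s : nat) : set V * V :=
  if s is s'.+1 then
    let D := [set w | reach G ((stage v s').1 `\` [set (stage v s').2]) v w] in
    (D, next D (stage v s').2)
  else (vertices G, r).

Let D v s := (stage v s).1.
Let X v s := (stage v s).2.

Lemma least_index_ex (A : set V) x : A x -> exists n, least_index A n.
Proof.
move=> Ax; have [|n [y Ay Uy] nmin] :=
    @ex_least (fun n => exists2 x, A x & U n x).
  by have [n Ux] := UT x; exists n, x.
by exists n; split=> [|m z Az Uz]; [exists y | apply: nmin; exists z].
Qed.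

Lemma next_closest (A : set V) t y :
  (forall x z, A x -> A z -> reach G A x z) -> A y -> adj G t y ->
  closest A t (next A t).
Proof.
move=> Ac Ay ty; suff ex : exists x, closest A t x.
  by rewrite /next; case: pselect => // ex'; case: (cid ex').
have [n nleast] := least_index_ex Ay; have [[u Au Uu] _] := nleast.
have [k yu] := Ac _ _ Ay Au.
have [|l [x [Ax tx lx]] lmin] :=
    @ex_least (fun k => exists x, [/\ A x, adj G t x & near A x k]).
  by exists k, y; split=> //; exists n, u.
by exists x; split=> //; exists l => // x' k' *; apply: lmin; exists x'.
Qed.

Lemma stage_step v s x y : D v s.+1 x -> adj G x y ->
  (D v s `\` [set X v s]) y -> D v s.+1 y.
Proof.
move=> Dx xy Ay; apply: (reach_trans Dx); apply: reach_edge xy => //.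
by case: Dx => k vx; apply: walk_lst vx.
Qed.

Lemma stage_connected v s x y : D v s x -> D v s y -> reach G (D v s) x y.
Proof.
case: s => [|s]; first exact: connected_reach.
have inv w z : D v s.+1 w -> reach G (D v s `\` [set X v s]) w z ->
    reach G (D v s.+1) w z.
  move=> Dw [k wz]; exists k.
  have step a b (_ : (D v s `\` [set X v s]) a) := @stage_step v s a b.
  by apply: walk_sub (walk_invariant step wz Dw) => ? [].
move=> Dx Dy; apply: inv => //.
by apply: reach_trans (reach_sym Dx) Dy.
Qed.

Lemma stageS v s w : D v s.+1 w -> D v s w /\ w <> X v s.
Proof. by move=> [k vw]; have [] := walk_lst vw. Qed.

Lemma stage_le v s t w : s <= t -> D v t w -> D v s w.
Proof.
move=> /subnKC<-; elim: (t - s) => [|k IH]; rewrite ?addn0 // addnS.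
by move=> /stageS[/IH].
Qed.

(** A component is determined by any of its vertices, and [next] ignores the target. *)
Lemma stage_coherent v w s : D v s w -> stage w s = stage v s.
Proof.
elim: s => // s IH Dw; have [/IH E _] := stageS Dw.
suff DE : D w s.+1 = D v s.+1.
  by move: DE; rewrite /D /= E => ->.
rewrite /D /= E; apply/seteqP; split=> z; first exact: reach_trans.
exact: reach_trans (reach_sym Dw).
Qed.

(** Stopping before the first visit to [x] shows that the current branch vertex has a neighbour in
    the component in which [v] remains. *)
Lemma walk_last_step (A : set V) k v x : walk G A k v x -> v <> x ->
  exists2 y, reach G (A `\` [set x]) v y & adj G y x.
Proof.
elim=> [//|{}k {}v w {}x Av vw wx IH vx].
have [wE|wN] := pselect (w = x).
  by exists v; [apply: reach_refl | rewrite -wE].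
have [y wy yx] := IH wN; exists y => //.
apply: reach_trans wy; apply: reach_edge => //; split=> //.
exact: walk_fst wx.
Qed.

Lemma walk_avoid (A : set V) z k x u : walk G A k x u ->
  walk G (A `\` [set z]) k x u \/ exists2 l, l <= k & walk G A l z u.
Proof.
elim=> [{}x Ax|{}k {}x y {}u Ax xy yu IH].
  have [<-|xz] := pselect (x = z); last by left; apply: walk_nil.
  by right; exists 0 => //; apply: walk_nil.
have [<-|xz] := pselect (x = z).
  by right; exists k.+1 => //; apply: walk_cons xy yu.
have [yu'|[l lk zu]] := IH; last by right; exists l => //; apply: leqW.
by left; apply: walk_cons xy yu'.
Qed.

Let alive v s := vertices G v /\ forall j, j < s -> X v j <> v.

Lemma aliveW v s t : s <= t -> alive v t -> alive v s.
Proof.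
by move=> st [Gv av]; split=> // j js; apply: av; apply: leq_trans st.
Qed.

Lemma alive_stage v s : alive v s -> D v s v.
Proof.
elim: s => [[]//|s IH] av; apply: reach_refl; split.
  by apply: IH; apply: aliveW av.
by move=> vE; case: av => _ /(_ s (leqnn _)); apply.
Qed.

Lemma alive_next v s : D v s (X v s) -> alive v s.+1 ->
  closest (D v s.+1) (X v s) (X v s.+1).
Proof.
move=> DX av; have avs := aliveW (leqnSn s) av.
have [k vx] := stage_connected (alive_stage avs) DX.
have [|y vy yx] := walk_last_step vx.
  by move=> vE; case: av => _ /(_ s (leqnn _)); apply.
apply: (@next_closest _ _ y) => //; last exact: adj_sym.
exact: stage_connected.
Qed.

Lemma alive_mem v s : alive v s -> D v s (X v s).
Proof.
elim: s => [//|s IH] av.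
by have [] := alive_next (IH (aliveW (leqnSn s) av)) av.
Qed.

Lemma alive_closest v s : alive v s.+1 ->
  closest (D v s.+1) (X v s) (X v s.+1).
Proof.
by move=> av; apply: alive_next (av); apply: alive_mem; apply: aliveW av.
Qed.

(* If the branch towards [v] never reached [v], it would be a ray; from some
   point on it heads for the same [U n], and infinitely many disjoint paths
   leave it for [U n]. *)
Lemma branch_reaches v : vertices G v -> exists s, X v s = v.
Proof.
move=> Gv; apply: contrapT => vN.
have av s : alive v s by split=> // j _ jv; apply: vN; exists j.
have ray : is_ray G (X v).
  split=> [s t st|s]; last by have [] := alive_closest (av s.+1).
  have lt_neq a b : a < b -> X v a <> X v b.
    move=> ab E; have := alive_mem (av b); rewrite -E.
    by move=> /(stage_le ab)/stageS[_]; apply.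
  by have [/lt_neq|/lt_neq/(_ (esym st))|] := ltngtP s t.
have /choice[idx idxP] : forall s, exists n, least_index (D v s) n.
  by move=> s; apply: least_index_ex (alive_stage (av s)).
have [m Um] := UT v.
(* The components shrink, so their least indices grow; all contain [v], which lies in [U m]. *)
have [|s|N0 N0P] := @bounded_nondecreasing_stationary idx m.
- move=> s; have [[x /stageS[Dx _] Ux] _] := idxP s.+1.
  by have [_ min] := idxP s; apply: min Dx Ux.
- by have [_ min] := idxP s; apply: min (alive_stage (av s)) Um.
set n := idx N0 in N0P.
have index_unique s n' : N0 <= s -> least_index (D v s) n' -> n' = n.
  move=> Ns [[x' Dx' Ux'] min']; have [[x Dx Ux] min] := idxP s.
  rewrite -(N0P s Ns); apply/eqP.
  by rewrite eqn_leq (min _ _ Dx' Ux') (min' _ _ Dx Ux).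
have [Y Yfin YU] := Ud n ray.
(* Each vertex of [Y] drops out of the shrinking components at most once, so none does from [N1]
   on. *)
have [|N1 N1P] := @finite_eventually _ Y
    (fun y s => D v s y -> D v s.+1 y) Yfin.
  move=> y _; have [[j [Dj NDj]]|jN] :=
    pselect (exists j, D v j y /\ ~ D v j.+1 y).
    by exists j.+1 => i ji Di; case: NDj; apply: stage_le Di.
  by exists 0 => i _ Di; apply: contrapT => NDi; apply: jN; exists i.
have XY s : N1 <= s -> ~ Y (X v s).
  move=> Ns /N1P/(_ Ns)/(_ (alive_mem (av s)))/stageS[_]; exact.
(* A walk that returns to [X v s] can be shortened. If its first step enters [D v s.+1], the next
   branch vertex is at least as close to [U n] as the vertex entered, which gives a shorter walk.
   Otherwise it runs outside [D v s.+1], hence avoids [Y], contradicting the choice of [Y]. *)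
have far k : forall s u, maxn N0 N1 <= s -> U n u ->
    ~ walk G (D v s) k (X v s) u.
  elim/ltn_ind: k => k IH s u Ns Uu xu.
  have NsY : ~ Y (X v s) by apply: XY; lia.
  have [xE|[l [y [kl xy yu]]]] := walk_inv xu.
    by apply: (YU s u) => //; rewrite -xE; apply: reach_refl.
  have [yu'|[l' l'l xu']] := walk_avoid (X v s) yu; last first.
    by apply: IH Ns Uu xu'; lia.
  have [Dy|NDy] := pselect (D v s.+1 y).
    have [_ _ [k' [n' [u' [n'least Uu' xu']]] k'min]] :=
      alive_closest (av s.+1).
    have n'n : n' = n by apply: index_unique n'least; lia.
    rewrite n'n in n'least Uu'; apply: IH xu' => //; [|by lia].
    rewrite kl ltnS; apply: (k'min _ _ Dy xy); exists n, u; split=> //.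
    apply: walk_sub (walk_invariant _ yu' Dy) => [? []//|a b _ Da ab Ab].
    exact: stage_step Da ab Ab.
  apply: (YU s u) => //; apply: (@reach_trans _ _ _ _ y).
    apply: reach_edge => // Yy; apply: NDy; apply: N1P => //; first by lia.
    by have [] := walk_fst yu'.
  exists l.
  apply: (walk_sub _ (@walk_invariant _ _ _ (~` D v s.+1) _ _ _ _ yu' NDy)).
    by move=> a [[Da _] NDa] Ya; apply: NDa; apply: N1P => //; lia.
  move=> a b Aa NDa ab Ab Db; apply: NDa.
  by apply: stage_step Db (adj_sym ab) Aa.
have [_ _ [k [n' [u [n'least Uu xu]]] _]] := alive_closest (av (maxn N0 N1).+1).
have n'n : n' = n by apply: index_unique n'least; lia.
by rewrite n'n in Uu; apply: far Uu xu; apply: leqnSn.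
Qed.

Theorem sigma_dispersed_normal_spanning_tree : has_normal_spanning_tree G.
Proof.
have /choice[h hP] : forall v, exists n, vertices G v ->
    X v n = v /\ forall m, X v m = v -> n <= m.
  move=> v; have [Gv|] := pselect (vertices G v); last by exists 0.
  by have [n Xn nmin] := ex_least (branch_reaches Gv); exists n.
have hal v s : vertices G v -> s <= h v -> alive v s.
  move=> Gv sh; split=> // j js Xj; have [_ /(_ _ Xj)] := hP _ Gv; lia.
have DG v s w : D v s w -> vertices G w by apply: stage_le (leq0n s).
(* By coherence the branch of [w] also has [w] at stage [s]; had it reached [w] earlier, [w] would
   have been deleted from [D v s]. *)
have hX v w s : D v s w -> w = X v s -> h w = s.
  move=> Dw wE; have Gw := DG _ _ _ Dw.
  have [Xw hmin] := hP _ Gw; apply/eqP; rewrite eqn_leq hmin; last first.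
    by rewrite /X (stage_coherent Dw) -/(X v s).
  rewrite leqNgt; apply/negP => hs; have Dh := stage_le hs Dw.
  have [Dh' NX] := stageS Dh; apply: NX.
  by rewrite -{1}Xw /X (stage_coherent Dh').
suff bP : branches G r h X.
  by exists (branch_tree bP), r; apply: branches_normal_tree.
split.
- by [].
- by move=> v /hP[].
- by move=> v i Gv ih; have [] := alive_closest (hal v i.+1 Gv ih).
- move=> v i Gv ih; have Di := alive_mem (hal _ _ Gv ih).
  split; [exact: DG Di | exact: hX Di _ | move=> j ji].
  by rewrite /X (stage_coherent (stage_le ji Di)).
suff main u v : adj G u v -> h u <= h v -> X v (h u) = u.
  move=> u v uv; have [uv'|/ltnW vu] := leqP (h u) (h v); [left|right].
    by split=> //; apply: main.
  by split=> //; apply: main => //; apply: adj_sym.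
move=> uv huv; have Gu := adj_vertices uv; have Gv := adj_vertices (adj_sym uv).
(* Neither end of the edge is deleted before stage [h u], so [v] stays in the component of [u] and
   the two branches agree up to [u]. *)
suff Dv j : j <= h u -> D u j v.
  by rewrite /X (stage_coherent (Dv _ (leqnn _))); have [] := hP _ Gu.
elim: j => // j IH ju; have Dj := IH (ltnW ju).
have Du := alive_stage (hal u j.+1 Gu ju).
apply: stage_step Du uv _; split=> //= vX.
have [_ /(_ j)] := hP _ Gv; rewrite {1}/X (stage_coherent Dj).
by move=> /(_ (esym vX)); lia.
Qed.

End Jung.

(** * From ends to cells around rays *)

Lemma ray_equiv_refl (V : Type) (G : graph V) p : is_ray G p -> ray_equiv G p p.
Proof.
move=> pray X Xfin _ sep; have [N NX] := ray_eventually_notin pray Xfin.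
have [_ pE] := pray.
(* The trivial path at a vertex of the ray past [X] cannot be blocked. *)
have [|||i _] := sep 0 (fun=> p N).
- split=> [i _|i j|//]; first exact: adj_vertices (pE N).
  by rewrite !leqn0 => /eqP-> /eqP->.
- by exists N.
- by exists N.
- exact: NX.
Qed.

Theorem theorem4p3 (V : Type) (G : graph V)
  (G_connected : is_connected G)
  (G_local : forall w : set (nat -> V), ends G w ->
     exists X : set V, [/\ finite_set X, X `<=` vertices G
       & exists C : graph V,
           end_component G X w C /\ has_normal_spanning_tree C]) :
  has_normal_spanning_tree G.
Proof.
have [[r Gr] _] := G_connected.
have [p pray|U Ud UT] := @sigma_dispersedT _ G.
  have [|X [Xfin _ [C [[CX Ctail] Cnst]]]] :=
    G_local [set q | is_ray G q /\ ray_equiv G p q]; first by exists p.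
  exists (vertices C); first exact: component_cell Xfin CX Cnst.
  by apply: Ctail; split=> //; apply: ray_equiv_refl.
apply: (sigma_dispersed_normal_spanning_tree G_connected Gr Ud) => x.
by have [n _ Ux] := UT x I; exists n.
Qed.
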